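(* Let $N$ be a finite set with $|N|=n\ge 1$ and let $f : 2^N \to \mathbb{Q}$ be a set function with $f(\emptyset)=0$. Then $$\mathrm{epi}\,\hat f \;\subseteq\; \mathcal{Q}_f \;\subseteq\; \mathcal{P}_f^{\circ}\cap\big([0,1]^N\times\mathbb{R}\big).$$
   Context: For $x\in\{0,1\}^N$ write $f(x) := f(\{i\in N: x_i=1\})$. The convex hull of the epigraph of $f$ is $\mathcal{Q}_f := \mathrm{conv}\{(x,z)\in\{0,1\}^N\times\mathbb{R} : f(x)\le z\}\subseteq\mathbb{R}^N\times\mathbb{R}$. For $\pi\in\mathbb{R}^N$ and $S\subseteq N$, $\pi(S):=\sum_{i\in S}\pi_i$, and $\pi x := \sum_{i\in N}\pi_i x_i$. The polyhedron associated with $f$ is $\mathcal{P}_f := \{\pi\in\mathbb{R}^N : \pi(S)\le f(S) \text{ for all } S\subseteq N\}$, and its polar is $\mathcal{P}_f^{\circ} := \{(x,z)\in\mathbb{R}^N\times\mathbb{R} : \pi x\le z \text{ for all } \pi\in\mathcal{P}_f\}$. The Lovász extension $\hat f:[0,1]^N\to\mathbb{R}$ is defined as follows: given $x\in[0,1]^N$, order the elements of $N$ as $(1),\dots,(n)$ so that $1\ge x_{(1)}\ge\cdots\ge x_{(n)}\ge 0$, let $S_{(i)}=\{(1),\dots,(i)\}$, and set $\hat f(x) := \sum_{i=1}^{n-1}(x_{(i)}-x_{(i+1)})f(S_{(i)}) + x_{(n)}f(S_{(n)})$ (the value does not depend on how ties are broken). Its epigraph is $\mathrm{epi}\,\hat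 f := \{(x,z)\in[0,1]^N\times\mathbb{R} : \hat f(x)\le z\}$. *)

(* Defs.v *)
From HB Require Import structures.
From mathcomp Require Import all_boot all_order all_algebra.
From mathcomp Require Import boolp classical_sets reals convex.

Set Implicit Arguments.
Unset Strict Implicit.
Unset Printing Implicit Defensive.

Import Order.TTheory GRing.Theory Num.Theory.

Local Open Scope classical_set_scope.
Local Open Scope ring_scope.

(* R^N and R^N x R; the alias R^o provides the module structure of R over
   itself, from which the pointwise R-module structures are inferred. *)
Notation vec R N := {ffun N -> R^o}.
Notation vecR R N := (vec R N * R^o)%type.

Section SetFunction.
Variables (R : realType) (N : finType).
Implicit Types (f : {set N} -> R) (x pi : vec R N) (s : seq N).

Definition binary_vec : set (vec R N) :=
  [set x : vec R N | forall i, x i = 0 \/ x i = 1].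

Definition unit_cube : set (vec R N) :=
  [set x : vec R N | forall i, 0 <= x i <= 1].

Definition eval_binary f x : R := f [set i | x i == 1]%SET.

Definition convex_hull (A : set (vecR R N)) : set (vecR R N) :=
  smallest (@convex_set R (vecR R N)) A.

Definition epigraph_hull f : set (vecR R N) :=
  convex_hull [set p : vecR R N | binary_vec p.1 /\ eval_binary f p.1 <= p.2].

Definition polyhedron f : set (vec R N) :=
  [set pi : vec R N | forall S : {set N}, \sum_(i in S) pi i <= f S].

Definition polar (P : set (vec R N)) : set (vecR R N) :=
  [set p : vecR R N | forall pi, P pi -> \sum_i pi i * p.1 i <= p.2].

(* The sum defining the Lovasz extension, along an enumeration s of N: x_(i),
   for 1 <= i <= #|N|, is the entry of index i.-1 of [seq x j | j <- s], and
   S_(i) consists of the first i elements of s. *)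
Definition lovasz_sum f s x : R :=
  let x_ i := nth 0 [seq x j | j <- s] i.-1 in
  let S_ i := [set j in take i s]%SET in
  \sum_(1 <= i < #|N|) (x_ i - x_ i.+1) * f (S_ i) + x_ #|N| * f (S_ #|N|).

Definition nonincreasing_along x : rel N := fun i j => x j <= x i.

(* This is the Lovasz extension only on unit_cube, where it is used; ties are
   broken by sort, which is immaterial by lovasz_sum_indep below. *)
Definition lovasz f x : R :=
  lovasz_sum f (sort (nonincreasing_along x) (enum N)) x.

Definition epi_lovasz f : set (vecR R N) :=
  [set p : vecR R N | unit_cube p.1 /\ lovasz f p.1 <= p.2].

Let geo_trans x : transitive (nonincreasing_along x).
Proof. by move=> i j k /[swap]; apply: le_trans. Qed.

Let take_level x s k : (k.+1 < size s)%N -> uniq s ->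
    sorted (nonincreasing_along x) s ->
    let v := nth 0 [seq x j | j <- s] in
    v k.+1 < v k -> forall j, j \in s -> (j \in take k.+1 s) = (v k.+1 < x j).
Proof.
move=> ks us ss v vlt j js.
have ji : (index j s < size s)%N by rewrite index_mem.
have vE i : (i < size s)%N -> v i = x (nth j s i).
  by move=> ?; rewrite /v (nth_map j).
have vmono a b : (a <= b)%N -> (b < size s)%N -> v b <= v a.
  move=> ab bs; rewrite !vE ?(leq_ltn_trans ab bs)//.
  have r : reflexive (nonincreasing_along x) by move=> ?; exact: lexx.
  apply: (sorted_leq_nth (@geo_trans x) r j ss) => //.
  by rewrite inE (leq_ltn_trans ab bs).
rewrite in_take //.
have xj : x j = v (index j s) by rewrite vE // nth_index.
rewrite xj; case: ltnP => h.
  by apply/esym/(lt_le_trans vlt)/vmono => //; apply: ltnW.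
by apply/esym/negbTE; rewrite -leNgt; apply: vmono.
Qed.

Lemma lovasz_sum_indep f x s : perm_eq s (enum N) ->
  sorted (nonincreasing_along x) s -> lovasz_sum f s x = lovasz f x.
Proof.
move=> pes ss; rewrite /lovasz; set t := sort _ _.
have pet : perm_eq t (enum N) by rewrite perm_sort.
have st : sorted (nonincreasing_along x) t.
  by apply: sort_sorted => i j; exact: le_total.
have xsE : [seq x j | j <- s] = [seq x j | j <- t].
  apply: (@sorted_eq _ (fun a b : R => b <= a)).
  - by move=> a b c /[swap]; apply: le_trans.
  - by move=> a b; rewrite andbC => /le_anti.
  - by rewrite sorted_map.
  - by rewrite sorted_map.
  - by apply: perm_map; rewrite (perm_trans pes)// perm_sym.
have sz u : perm_eq u (enum N) -> size u = #|N|.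
  by move=> /perm_size ->; rewrite -cardT.
have un u : perm_eq u (enum N) -> uniq u.
  by move=> /perm_uniq ->; exact: enum_uniq.
have me u j : perm_eq u (enum N) -> j \in u.
  by move=> /perm_mem ->; rewrite mem_enum.
rewrite /lovasz_sum xsE; congr (_ + _ * f _); last first.
  by apply/setP => j; rewrite !inE !take_oversize ?sz // !me.
rewrite !big_nat; apply: eq_bigr => -[//|k] /andP[_ kN] /=.
case: (eqVneq (nth 0 [seq x j | j <- t] k) (nth 0 [seq x j | j <- t] k.+1)).
  by move=> ->; rewrite subrr !mul0r.
move=> ne; congr (_ * f _); apply/setP => j; rewrite !inE.
have lt : nth 0 [seq x j | j <- t] k.+1 < nth 0 [seq x j | j <- t] k.
  rewrite lt_neqAle eq_sym ne /= !(nth_map j) ?sz // 1?ltnW //.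
  by move/(sortedP j): st; apply; rewrite sz.
have szs := sz _ pes; have szt := sz _ pet.
rewrite (@take_level x s k) ?szs ?un ?xsE //; last exact: me.
by rewrite (@take_level x t k) ?szt ?un //; exact: me.
Qed.

End SetFunction.

Arguments binary_vec {R N}.
Arguments unit_cube {R N}.

(* Main.v *)
Require Import Defs.
From mathcomp Require Import all_boot all_order all_algebra.
From mathcomp Require Import boolp classical_sets reals.
From mathcomp Require Import interval_inference convex.

Import Order.TTheory GRing.Theory Num.Theory.

Local Open Scope classical_set_scope.
Local Open Scope ring_scope.

(** With x_(0) = 1 and x_(n+1) = 0, the weights x_(k) - x_(k+1) for k = 0, ..., n
    are nonnegative and sum to 1. They write x as a convex combination of the
    indicators of the sets S_(k), and, as f vanishes at the empty set, the Lovasz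
    extension at x is the same combination of the values f(S_(k)). Adding the
    slack z - lovasz f x to every height f(S_(k)) then writes any point (x, z) of
    the epigraph as a convex combination of points of the epigraph of f. The
    second inclusion holds because the right-hand side is convex and contains
    the points that generate the hull. *)

(** Replaces the bundled interval scalar by a plain [t] with explicit bounds. *)
Lemma convex_setP (R : numDomainType) (M : lmodType R) (A : set M) :
  @convex_set R M A <->
  forall (x y : M) (t : R), 0 <= t <= 1 -> A x -> A y -> A (t *: x + (1 - t) *: y).
Proof.
split=> [cA x y t /andP[t0 t1] Ax Ay|cA x y t].
  by have /set_mem := cA x y (Itv01 t0 t1) (mem_set Ax) (mem_set Ay).
move=> /set_mem Ax /set_mem Ay; apply/mem_set.
by apply: cA => //; apply/andP; split; [exact: ge0|exact: le1].
Qed.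

Lemma convex_set_sum (R : numFieldType) (M : lmodType R) (A : set M)
    (I : Type) (r : seq I) (P : pred I) (w : I -> R) (F : I -> M) :
  @convex_set R M A -> (forall i, P i -> 0 <= w i) -> (forall i, P i -> A (F i)) ->
  \sum_(i <- r | P i) w i = 1 -> A (\sum_(i <- r | P i) w i *: F i).
Proof.
move=> /convex_setP cA w0 AF w1.
set W := fun s => \sum_(i <- s | P i) w i.
have W_ge0 s : 0 <= W s by exact: sumr_ge0.
have sumW0 s : W s = 0 -> \sum_(i <- s | P i) w i *: F i = 0.
  elim: s => [|i s IH]; first by rewrite big_nil.
  rewrite /W !big_cons; case: ifP => // Pi.
  move=> /eqP; rewrite paddr_eq0 ?w0 //; last exact: W_ge0.
  by move=> /andP[/eqP-> /eqP/IH->]; rewrite scale0r addr0.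
(* The weights of a tail of [r] need not sum to 1, so the induction runs on the normalised
   combination. *)
suff: W r != 0 -> A ((W r)^-1 *: \sum_(i <- r | P i) w i *: F i).
  by rewrite /W w1 invr1 scale1r oner_eq0; apply.
elim: r {w1} => [|i s IH]; first by rewrite /W big_nil eqxx.
rewrite /W !big_cons; case: ifP => // Pi; rewrite -/(W s).
(* A tail of total weight 0 cannot be normalised, but its combination vanishes and only [F i]
   remains. *)
have [Ws0|Ws0] := eqVneq (W s) 0.
  rewrite Ws0 sumW0 // !addr0 => wi0.
  by rewrite scalerA mulVf // scale1r; exact: AF.
move=> W0; have W_gt0 : 0 < w i + W s by rewrite lt0r W0 addr_ge0 ?w0 ?W_ge0.
set T := \sum_(j <- s | P j) w j *: F j.
have -> : (w i + W s)^-1 *: (w i *: F i + T) =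
    (w i / (w i + W s)) *: F i + (1 - w i / (w i + W s)) *: ((W s)^-1 *: T).
  rewrite scalerDr !scalerA [_^-1 * w i]mulrC; congr (_ + _ *: _).
  by rewrite -[X in X - _](divff W0) -mulrBl addrAC subrr add0r mulrAC divff ?mul1r.
apply: cA; [|exact: AF|exact: IH].
by rewrite divr_ge0 ?w0 ?(ltW W_gt0) //= ler_pdivrMr // mul1r lerDl W_ge0.
Qed.

Section Hull.
Variables (R : realType) (N : finType).
Implicit Types (f : {set N} -> R) (S : {set N}).

Definition indicator S : vec R N := [ffun i => (i \in S)%:R].

Lemma epigraph_hull_indicator f S z :
  f S <= z -> epigraph_hull f (indicator S, z).
Proof.
move=> fz; apply: sub_gen_smallest; split=> /=.
  by move=> i; rewrite ffunE; case: (i \in S); [right|left].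
rewrite /eval_binary (_ : [set i | _]%SET = S) //.
by apply/setP => i; rewrite inE ffunE pnatr_eq1 eqb1.
Qed.

(** The hull is the intersection of all convex supersets, so convexity is inherited from each of
    them. *)
Lemma convex_epigraph_hull f : @convex_set R (vecR R N) (epigraph_hull f).
Proof.
apply/convex_setP => x y t t01 hx hy A [cA fA].
by move/convex_setP: (cA); apply=> //; [apply: hx|apply: hy].
Qed.

(** The polar is an intersection of half-spaces, one for each [pi] in [P]. *)
Lemma convex_polar (P : set (vec R N)) : @convex_set R (vecR R N) (polar P).
Proof.
apply/convex_setP => -[x a] [y b] t /andP[t0 t1] hx hy pi Ppi /=.
under eq_bigr do rewrite !ffunE mulrDr !(mulrCA (pi _)).
rewrite big_split /= -!mulr_sumr lerD // ler_wpM2l ?subr_ge0 //.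
  exact: hx.
exact: hy.
Qed.

Lemma convex_cube_cylinder :
  @convex_set R (vecR R N) (unit_cube `*` [set: R]).
Proof.
apply/convex_setP => -[x a] [y b] t /andP[t0 t1] [/= hx _] [/= hy _].
have t1' : 0 <= 1 - t by rewrite subr_ge0.
split=> //= i; rewrite !ffunE.
have /andP[x0 x1] := hx i; have /andP[y0 y1] := hy i.
rewrite addr_ge0 ?mulr_ge0 //= -[leRHS](subrKC t).
by rewrite lerD // -[leRHS]mulr1 ler_wpM2l.
Qed.

Lemma epigraph_hull_sub_polar f :
  epigraph_hull f `<=` polar (polyhedron f) `&` (unit_cube `*` [set: R]).
Proof.
apply: smallest_sub.
  apply/convex_setP => x y t t01 [px cx] [py cy]; split.
    by move/convex_setP: (@convex_polar (polyhedron f)); apply.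
  by move/convex_setP: convex_cube_cylinder; apply.
move=> [x z] [/= bx fz]; split; last first.
  by split=> // i /=; case: (bx i) => ->; rewrite ?lexx ?ler01.
(* At a binary [x] with support S, the product of [pi] and [x] is pi(S), which is at most f(S). *)
move=> pi /= Ppi; apply: le_trans fz; apply: le_trans (Ppi _).
rewrite [leRHS]big_mkcond /=; apply: ler_sum => i _; rewrite inE.
by case: (bx i) => ->; rewrite ?eqxx ?mulr1 ?mulr0 // eq_sym oner_eq0.
Qed.

Lemma epi_lovasz_sub_hull f :
  (0 < #|N|)%N -> f finset.set0 = 0 -> epi_lovasz f `<=` epigraph_hull f.
Proof.
move=> N_gt0 f0 [x z] [/= cx]; rewrite /lovasz; set s := sort _ _ => fz.
have ss : sorted (nonincreasing_along x) s.
  by apply: sort_sorted => i j; exact: le_total.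
have sizes : size s = #|N| by rewrite size_sort cardE.
have mems i : i \in s by rewrite mem_sort mem_enum.
(* Prepending the value [1] to the sorted coordinates gives the empty set the
   weight [1 - x_(1)]; past the end, [nth] supplies x_(n+1) = 0. *)
pose v := nth 0 (1 :: [seq x j | j <- s]).
pose w k := v k - v k.+1.
pose S k := [set j in take k s]%SET.
have vlast : v #|N|.+1 = 0 by rewrite /v nth_default //= size_map sizes.
have w_ge0 k : 0 <= w k.
  rewrite subr_ge0 /v; case: k => [|k] /=.
    by case: (s) => [|i t] //=; have /andP[] := cx i.
  (* Past the last coordinate the smaller value is the default 0, and nonnegativity of [x] suffices;
     before it, sortedness does. *)
  have [ks|ks] := ltnP k.+1 (size s); last first.
    rewrite [leLHS]nth_default ?size_map //.
    have [ks'|ks'] := ltnP k (size s); last by rewrite nth_default ?size_map.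
    case: s ks' {ss sizes mems v w S vlast ks fz} => // i t ks'.
    by rewrite (nth_map i) //; have /andP[] := cx (nth i (i :: t) k).
  case: s ss ks {sizes mems v w S vlast fz} => // i t ss ks.
  rewrite !(nth_map i) // 1?ltnW //.
  by move/(sortedP i): ss; apply.
(* Tails telescope: [m = 0] gives total weight 1, larger [m] recovers the coordinates of [x]. *)
have w_sum m : (m <= #|N|.+1)%N -> \sum_(m <= k < #|N|.+1) w k = v m.
  move=> mN; rewrite -[LHS]opprK -sumrN.
  under eq_bigr do rewrite opprB.
  by rewrite telescope_sumr // vlast sub0r opprK.
have lovaszE : lovasz_sum f s x = \sum_(0 <= k < #|N|.+1) w k * f (S k).
  rewrite big_nat_recr //= big_ltn // {1}/S take0.
  rewrite [X in f X](_ : _ = finset.set0) ?f0; last by apply/setP => i; rewrite !inE.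
  rewrite mulr0 add0r /lovasz_sum; congr (_ + _).
    (* For positive [k], the prepended 1 makes [v k] the entry of index [k.-1]. *)
    by apply: eq_big_nat => -[].
  by rewrite /w vlast subr0; case: (#|N|) N_gt0.
have xE i : x i = \sum_(0 <= k < #|N|.+1) w k * (i \in S k)%:R.
  have iN : (index i s < #|N|)%N by rewrite -sizes index_mem.
  have iN1 : ((index i s).+1 <= #|N|.+1)%N by exact: ltnW.
  (* As [i] lies in [S k] exactly when [index i s < k], only the tail from [(index i s).+1]
     contributes. *)
  rewrite (big_cat_nat (leq0n _) iN1) /= big_nat_cond big1.
    rewrite add0r; transitivity (v (index i s).+1).
      by rewrite /v /= (nth_map i) ?sizes // nth_index.
    rewrite -w_sum 1?ltnW //; apply: eq_big_nat => k /andP[ik _].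
    by rewrite inE in_take // ik mulr1.
  by move=> k /andP[/andP[_ ki] _]; rewrite inE in_take // ltnNge -ltnS ki mulr0.
pose F k : vecR R N := (indicator (S k), f (S k) + (z - lovasz_sum f s x)).
have -> : (x, z) = \sum_(0 <= k < #|N|.+1) w k *: F k.
  rewrite [RHS]surjective_pairing.
  rewrite (big_morph fst (id1 := 0) (op1 := +%R)) //.
  rewrite (big_morph snd (id1 := 0) (op1 := +%R)) //; congr (_, _).
    by apply/ffunP => i; rewrite sum_ffunE xE; apply: eq_bigr => k _; rewrite !ffunE.
  under eq_bigr do rewrite /= /GRing.scale /= mulrDr.
  by rewrite big_split /= -lovaszE -mulr_suml w_sum // mul1r subrKC.
apply: convex_set_sum; first exact: convex_epigraph_hull.
- by move=> k _; exact: w_ge0.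
- by move=> k _; apply: epigraph_hull_indicator; rewrite lerDl subr_ge0.
- by rewrite w_sum.
Qed.

End Hull.

Theorem mainTheorem5 (R : realType) (N : finType) (f : {set N} -> rat)
    (N_gt0 : (0 < #|N|)%N) (f0 : f finset.set0 = 0) :
  let fR : {set N} -> R := fun S => ratr (f S) in
  epi_lovasz fR `<=` epigraph_hull fR /\
  epigraph_hull fR `<=` polar (polyhedron fR) `&` (unit_cube `*` setT).
Proof.
move=> fR; split; last exact: epigraph_hull_sub_polar.
by apply: epi_lovasz_sub_hull => //; rewrite /fR f0 rmorph0.
Qed.
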